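(* There is no arc-transitive nontrivially unstable circulant graph. In other words, a connected arc-transitive circulant graph is stable if and only if it is non-bipartite and vertex-determining.
   Context: All graphs are finite, simple and undirected. For a group $G$ and a nonempty inverse-closed subset $S$ of $G\setminus\{1\}$, the Cayley graph $\mathrm{Cay}(G,S)$ has vertex set $G$, with $x,y$ adjacent if and only if $yx^{-1}\in S$. A circulant graph (circulant) is a Cayley graph of a cyclic group. A graph is arc-transitive if its automorphism group acts transitively on its set of arcs (ordered pairs of adjacent vertices). The canonical double cover $\mathrm{D}(\Gamma)$ of a graph $\Gamma$ is the graph with vertex set $V(\Gamma)\times\mathbb{Z}_2$ in which $(u,x)$ and $(v,y)$ are adjacent if and only if $u$ and $v$ are adjacent in $\Gamma$ and $x\neq y$. One always has that $\mathrm{Aut}(\Gamma)\times\mathbb{Z}_2$ is isomorphic to a subgroup of $\mathrm{Aut}(\mathrm{D}(\Gamma))$. The graph $\Gamma$ is called stable if $\mathrm{Aut}(\mathrm{D}(\Gamma))\cong\mathrm{Aut}(\Gamma)\times\mathbb{Z}_2$, and unstable otherwise. A graph is vertex-determining if distinct vertices have different neighborhoods. A graph is nontrivially unstable if it is connected, non-bipartite, vertex-determining and unstable. *)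

(* Defs.v *)
From HB Require Import structures.
From mathcomp Require Import all_boot all_fingroup cyclic zmodp.

Set Implicit Arguments.
Unset Strict Implicit.
Unset Printing Implicit Defensive.

Import GroupScope.

(* A simple graph on a finite type T is given by its adjacency relation, an
   irreflexive symmetric [e : rel T]. *)

Section Graphs.

Variables (T : finType) (e : rel T).

Definition graph_aut : {set {perm T}} :=
  [set p : {perm T} | [forall x, forall y, e (p x) (p y) == e x y]].

Lemma graph_autP (p : {perm T}) :
  reflect (forall x y, e (p x) (p y) = e x y) (p \in graph_aut).
Proof.
rewrite inE; apply: (iffP forallP) => [H x y | H x].
  by move/forallP: (H x) => /(_ y)/eqP.
by apply/forallP=> y; rewrite H.
Qed.

Lemma graph_aut_group_set : group_set graph_aut.
Proof.
apply/group_setP; split; first by apply/graph_autP=> x y; rewrite !perm1.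
move=> p q /graph_autP Hp /graph_autP Hq.
by apply/graph_autP=> x y; rewrite !permM Hq Hp.
Qed.

Canonical graph_aut_group := Group graph_aut_group_set.

Definition arc_transitive : Prop :=
  forall x y u v, e x y -> e u v ->
  exists2 p, p \in graph_aut & p x = u /\ p y = v.

Definition connected_graph : Prop := forall x y, connect e x y.

Definition bipartite : Prop :=
  exists c : T -> bool, forall x y, e x y -> c x != c y.

Definition neighborhood (x : T) : {set T} := [set y | e x y].

Definition vertex_determining : Prop := injective neighborhood.

Definition double_cover : rel (T * 'Z_2) :=
  fun u v => e u.1 v.1 && (u.2 != v.2).

End Graphs.

(* [setX] of two groups is their external direct product; the group structure
   of ['Z_2] is the additive one. *)
Definition stable_graph (T : finType) (e : rel T) : Prop :=
  graph_aut (double_cover e) \isog setX (graph_aut e) [set: 'Z_2].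

Definition nontrivially_unstable (T : finType) (e : rel T) : Prop :=
  [/\ connected_graph e, ~ bipartite e, vertex_determining e & ~ stable_graph e].

Definition connection_set (gT : finGroupType) (S : {set gT}) : Prop :=
  [/\ S != set0, 1 \notin S & forall x, x \in S -> x^-1 \in S].

Definition cayley (gT : finGroupType) (S : {set gT}) : rel gT :=
  fun x y => y * x^-1 \in S.

Lemma cayley_irreflexive (gT : finGroupType) (S : {set gT}) :
  connection_set S -> irreflexive (cayley S).
Proof. by case=> _ S1 _ x; rewrite /cayley mulgV; apply: negbTE. Qed.

Lemma cayley_symmetric (gT : finGroupType) (S : {set gT}) :
  connection_set S -> symmetric (cayley S).
Proof.
case=> _ _ SV x y; rewrite /cayley.
by apply/idP/idP => /SV; rewrite invMg invgK.
Qed.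

Lemma double_cover_irreflexive (T : finType) (e : rel T) :
  irreflexive (double_cover e).
Proof. by move=> u; rewrite /double_cover eqxx andbF. Qed.

Lemma double_cover_symmetric (T : finType) (e : rel T) :
  symmetric e -> symmetric (double_cover e).
Proof. by move=> sym_e u v; rewrite /double_cover sym_e eq_sym. Qed.

(* Main.v *)
Require Import Defs.
From mathcomp Require Import all_boot all_fingroup cyclic zmodp pgroup.

(** Write [a, b] for a pair of permutations of the vertices with
    [e (a x) (b y) = e x y].  For a connected non-bipartite graph every
    automorphism of the double cover acts on the two layers by such a pair,
    up to exchanging the layers, so stability amounts to: every such pair has
    [a = b].  The converse half, that a bipartite graph or a graph with twins
    is unstable, comes from exhibiting an automorphism of the double cover that
    is not of this diagonal form.

    The engine is parity.  In a Cayley graph of an abelian group, reflecting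
    [z] to [x y / z] preserves the common neighbours of [x] and [y], so their
    number has the parity of the number of [s] in [S] with [s^2 = y / x].
    Since [b] carries common neighbours along, [a] is an automorphism of the
    Cayley graph of the set [S'] of elements with an odd number of square roots
    in [S] ([odd_squares_aut]).  Within a group of odd order, iterating this
    replaces [S] by its [2^i]-th powers, which is [S] itself for a suitable [i]
    ([aut_unsquare]).

    In odd order this makes [a] an automorphism of the graph, and absence of
    twins gives [a = b].  In even order let [t] be the involution, and let [M]
    be the group generated by [S'].
    - [S] misses [M]: otherwise arc-transitivity puts [S] into [M], a group of
      squares, against connectedness.
    - By arc-transitivity and because a cyclic group has one subgroup per order,
      a translation in [M] that preserves one slice of [S] by a coset of [M]
      preserves all of them, so it is trivial ([translation_period]).
    - An element of [S] whose square is not in [M] exists, since otherwise the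
      graph is bipartite; the slice through it is preserved by [t].  Therefore
      [t] is not in [M], [M] has odd order, and the slice of [S] in the coset
      [t M] is [t F] with [a] an automorphism of the Cayley graph of [F].
    - Each slice is a translate [w F] for a unique center [w]; the pair [a, b]
      respects the set [W] of centers, [t] is in [W], and [W] without [t] is
      preserved by [t].  As the stabilizer of [1] is transitive on [W], the
      quotient of two distinct elements of [W] is in [W], so the Cayley graph of
      [W] is a union of complete graphs, with at least three vertices each.
    For such unions of complete graphs [a = b] is immediate
    ([complete_twofold]). *)

Set Implicit Arguments.
Unset Strict Implicit.
Unset Printing Implicit Defensive.

Import GroupScope.

(** * Automorphisms of the double cover *)
Definition twofold (T : finType) (e : rel T) (a b : {perm T}) : Prop :=
  forall x y, e (a x) (b y) = e x y.

Section DoubleCover.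

Variables (T : finType) (e : rel T).

Lemma graph_aut_twofold (p : {perm T}) :
  p \in graph_aut e <-> twofold e p p.
Proof. by split=> /graph_autP. Qed.

Lemma twofold_sym (a b : {perm T}) :
  symmetric e -> twofold e a b -> twofold e b a.
Proof. by move=> se ab x y; rewrite se ab se. Qed.

Lemma twofold_inv (a b : {perm T}) : twofold e a b -> twofold e a^-1 b^-1.
Proof. by move=> ab x y; rewrite -ab !permKV. Qed.

(** [b y] and [a y] have the same neighbours. *)
Lemma twofold_aut_eq (a b : {perm T}) :
  vertex_determining e -> symmetric e ->
  twofold e a b -> a \in graph_aut e -> a = b.
Proof.
move=> vd se ab /graph_autP aa; apply/permP=> y; apply: vd.
apply/setP=> z; rewrite !inE -[z](permKV a) aa se.
by rewrite (twofold_sym se ab) se.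
Qed.

Lemma Z2_neq_add (i j k : 'Z_2) : (i * k != j * k) = (i != j).
Proof. by rewrite (inj_eq (mulIg k)). Qed.

(** The embedding of the automorphism group times ['Z_2] into the automorphisms
    of the double cover; the group law of ['Z_2], an addition, is written
    multiplicatively. *)
Definition layer_fun (u : {perm T} * 'Z_2) (v : T * 'Z_2) : T * 'Z_2 :=
  (u.1 v.1, v.2 * u.2).

Lemma layer_fun_inj u : injective (layer_fun u).
Proof.
move=> [x i] [y j] E; congr (_, _).
  exact: perm_inj (congr1 fst E).
exact: (mulIg u.2) (congr1 snd E).
Qed.

Definition layer_perm u : {perm T * 'Z_2} := perm (@layer_fun_inj u).

Lemma layer_permM : {morph layer_perm : u v / u * v}.
Proof.
by move=> u v; apply/permP=> w; rewrite permM !permE /layer_fun /= permM mulgA.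
Qed.

Definition layer_morphism : {morphism [set: {perm T} * 'Z_2] >-> {perm T * 'Z_2}} :=
  Morphism (in2W layer_permM).

Lemma layer_perm_inj (x0 : T) : injective layer_perm.
Proof.
move=> [a i] [b j] /permP E; congr (_, _); last first.
  by have := congr1 snd (E (x0, 1)); rewrite !permE /= !mul1g.
by apply/permP=> x; have := congr1 fst (E (x, 1)); rewrite !permE.
Qed.

Lemma Z2_cases (i : 'Z_2) : i = 1 \/ i = Zp1.
Proof. by case: i => [[|[|m]]] //= lm; [left|right]; apply: val_inj. Qed.

Lemma layer_perm_aut a k :
  a \in graph_aut e -> layer_perm (a, k) \in graph_aut (double_cover e).
Proof.
move/graph_autP=> aa; apply/graph_autP=> u v.
by rewrite !permE /double_cover /= aa Z2_neq_add.
Qed.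

(** The diagonal automorphisms form a subgroup isomorphic to the right-hand
    side of the definition of stability, so an abstract isomorphism forces, by
    counting, every automorphism to be diagonal. *)
Lemma stable_graphP (x0 : T) :
  stable_graph e <->
  forall p, p \in graph_aut (double_cover e) ->
    exists2 a, a \in graph_aut e & exists k, p = layer_perm (a, k).
Proof.
set G := setX (graph_aut e) [set: 'Z_2].
have injG : 'injm layer_morphism.
  by apply/injmP=> u v _ _; apply: layer_perm_inj x0 _ _.
have sub : layer_morphism @* G \subset graph_aut (double_cover e).
  apply/subsetP=> _ /morphimP[[a k] _ /setXP[aa _] ->].
  exact: layer_perm_aut.
have isoG : G \isog layer_morphism @* G.
  exact: sub_isog (subsetT _) injG.
split=> [st p paut | all_layer].
  have eqG : layer_morphism @* G = graph_aut (double_cover e).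
    apply/eqP; rewrite eqEcard sub.
    by rewrite -(card_isog isoG) (card_isog st) leqnn.
  move: paut; rewrite -eqG => /morphimP[[a k] _ /setXP[aa _] ->].
  by exists a => //; exists k.
suff eqG : layer_morphism @* G = graph_aut (double_cover e).
  by rewrite /stable_graph -eqG isog_sym.
apply/eqP; rewrite eqEsubset sub; apply/subsetP=> p /all_layer[a aa [k ->]].
by apply: (mem_morphim layer_morphism); [apply: in_setT | apply/setXP].
Qed.

Lemma Z2_neq_quotient (i j k l : 'Z_2) :
  i != j -> k != l -> i^-1 * k = j^-1 * l.
Proof.
move=> ij kl; apply/eqP/(implyP _ kl)/(implyP _ ij).
by move: i j k l {ij kl}; do 4 (case=> [[|[|?]]] //= ?).
Qed.

(** The shift of layer that [p] induces at a vertex is constant along the edges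
    of the double cover.  Over a vertex [x] it takes one value on each layer, and
    crossing an edge exchanges these two values: if they differ somewhere, they
    colour the graph with two colours. *)
Lemma double_cover_aut_layered (p : {perm T * 'Z_2}) :
  connected_graph e -> ~ bipartite e -> p \in graph_aut (double_cover e) ->
  exists k, forall x i, (p (x, i)).2 = i * k.
Proof.
move=> conn nbip /graph_autP paut.
pose f (u : T * 'Z_2) : 'Z_2 := u.2^-1 * (p u).2.
have fE x y i j : e x y -> i != j -> f (x, i) = f (y, j).
  move=> exy ij; apply: Z2_neq_quotient => //=.
  have: double_cover e (p (x, i)) (p (y, j)) by rewrite paut /double_cover exy.
  by case/andP.
suff [k fk]: exists k, forall x i, f (x, i) = k.
  by exists k => x i; rewrite -(fk x i) /f mulKVg.
have [/existsP[x /eqP fx] | /existsPn/= nf] := boolP [exists x, f (x, 1) == f (x, Zp1)].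
  exists (f (x, 1)); move=> y i.
  suff [f0 f1]: f (y, 1) = f (x, 1) /\ f (y, Zp1) = f (x, 1).
    by case: (Z2_cases i) => ->.
  have /connectP[s] := conn x y.
  elim: s x fx => [|z s IH] x fx /= => [_ -> //|/andP[exz sz] ey].
  have E0 : f (x, 1) = f (z, Zp1) by apply: fE.
  have E1 : f (x, Zp1) = f (z, 1) by apply: fE.
  by rewrite fx E1; apply: IH => //; rewrite -E0 -E1.
case: nbip; exists (fun x => f (x, 1) == 1) => x y exy.
have E0 : f (x, 1) = f (y, Zp1) by apply: fE.
move: (nf y); rewrite E0.
by case: (Z2_cases (f (y, 1))) => ->; case: (Z2_cases (f (y, Zp1))) => ->.
Qed.

Lemma stable_of_twofold (x0 : T) :
  connected_graph e -> ~ bipartite e ->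
  (forall a b, twofold e a b -> a = b) -> stable_graph e.
Proof.
move=> conn nbip tf; apply/(stable_graphP x0) => p paut.
have [k pk] := double_cover_aut_layered conn nbip paut.
have injl i : injective (fun x => (p (x, i)).1).
  move=> x y E; suff [] : (x, i) = (y, i) by [].
  by apply: (@perm_inj _ p); apply: injective_projections => //; rewrite !pk.
pose a i := perm (@injl i).
have pE x i : p (x, i) = (a i x, i * k).
  by rewrite [LHS]surjective_pairing pk permE.
move/graph_autP: paut => paut.
have ab : twofold e (a 1) (a Zp1).
  move=> x y; have := paut (x, 1) (y, Zp1).
  by rewrite !pE /double_cover /= Z2_neq_add !andbT.
have aE := tf _ _ ab; exists (a 1).
  by apply/graph_aut_twofold => x y; rewrite -[RHS]ab -aE.
exists k; apply/permP=> -[x i]; rewrite pE [RHS]permE /layer_fun /=.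
by case: (Z2_cases i) => -> //; rewrite aE.
Qed.

(** Exchanging two twins on a single layer is an automorphism of the double
    cover that acts differently on the two layers. *)
Lemma stable_vertex_determining : irreflexive e -> symmetric e ->
  stable_graph e -> vertex_determining e.
Proof.
move=> irr se st u v /setP Nuv; apply/eqP; apply/negPn/negP=> uv.
have euv y : e u y = e v y by have := Nuv y; rewrite !inE.
have et x y : e (tperm u v x) y = e x y.
  by case: tpermP => [->|->|] //; rewrite euv.
pose f (w : T * 'Z_2) := (if w.2 == 1 then tperm u v w.1 else w.1, w.2).
have finj : injective f.
  move=> [x i] [y j] E; have /= ij := congr1 snd E; rewrite -ij in E *.
  congr (_, _); have /= := congr1 fst E.
  by case: ifP => // _ /perm_inj.
have faut : perm finj \in graph_aut (double_cover e).
  apply/graph_autP=> -[x i] [y j]; rewrite !permE /double_cover /=.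
  by case: ifP => _; case: ifP => _; rewrite ?et // se et se ?et.
have [a _ [k /permP E]] := (stable_graphP u).1 st _ faut.
have := congr1 fst (E (u, 1)); have := congr1 fst (E (u, Zp1)).
by rewrite !permE /layer_fun /= tpermL => <- /eqP; rewrite eq_sym (negPf uv).
Qed.

End DoubleCover.
(** * Cayley graphs of abelian groups *)
Section AbelianCayley.

Variables (gT : finGroupType).
Hypothesis abG : abelian [set: gT].
Implicit Types (S R K : {set gT}) (x y z s : gT).

Lemma abelian_mulC (x y : gT) : x * y = y * x.
Proof.
by have /centsP := abG; apply; rewrite inE.
Qed.

Lemma cayley_mulr S a x y : cayley S (x * a) (y * a) = cayley S x y.
Proof. by rewrite /cayley invMg mulgA mulgK. Qed.

Lemma cayley1 S y : cayley S 1 y = (y \in S).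
Proof. by rewrite /cayley invg1 mulg1. Qed.

(** The double cover of a bipartite graph falls apart into two halves, and one may
    act on one half only.  A translation by an element [a] of [S] exchanges the
    colours, so composed with the exchange of layers it preserves each half. *)
Lemma stable_nonbipartite S :
  connection_set S -> stable_graph (cayley S) -> ~ bipartite (cayley S).
Proof.
case=> /set0Pn[a aS] _ _ st [c cP].
have ca x : c (a * x) = ~~ c x.
  have: cayley S x (a * x) by rewrite /cayley mulgK.
  by move/cP; case: (c x); case: (c _).
(* [half] is constant along the edges of the double cover: it separates the two
   halves, and [f] moves only the one where it is false. *)
pose half (u : gT * 'Z_2) := c u.1 == (u.2 == 1).
pose f u := if half u then u else (a * u.1, u.2 * Zp1).
have Z2S (i : 'Z_2) : (i * Zp1 == 1) = (i != 1) by case: (Z2_cases i) => ->.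
have halff u : half (f u) = half u.
  rewrite /f; case: ifP => // hu; rewrite -hu /half /= ca Z2S.
  by case: (c u.1); case: (u.2 == 1).
have finj : injective f.
  move=> u v E; have huv : half u = half v by rewrite -(halff u) E halff.
  move: E; rewrite /f huv; case: ifP => // _ E; apply: injective_projections.
    exact: (mulgI a) (congr1 fst E).
  exact: (mulIg (Zp1 : 'Z_2)) (congr1 snd E).
have adj_half u v : double_cover (cayley S) u v -> half u = half v.
  case/andP=> /cP; rewrite /half.
  case: (Z2_cases u.2) => ->; case: (Z2_cases v.2) => -> //=;
  by case: (c _); case: (c _).
have faut : perm finj \in graph_aut (double_cover (cayley S)).
  apply/graph_autP=> u v; rewrite !permE.
  have [huv|nhuv] := eqVneq (half u) (half v); last first.
    have /negbTE-> : ~~ double_cover (cayley S) u v.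
      by apply: contra nhuv => /adj_half ->.
    apply/negbTE; apply: contra nhuv => /adj_half.
    by rewrite !halff => ->.
  rewrite /f huv; case: ifP => // _; rewrite /double_cover /= Z2_neq_add.
  by rewrite ![a * _]abelian_mulC cayley_mulr.
have [b _ [k /permP E]] := (stable_graphP _ (1 : gT)).1 st _ faut.
(* Over the vertex [1], one layer lies in the fixed half and the other does not:
   the shifts of layer are different. *)
pose i : 'Z_2 := if c 1 then 1 else Zp1.
have hi : half (1, i) by rewrite /half /= /i; case: (c 1).
have hj : half (1, i * Zp1) = false.
  by rewrite /half /= /i; case: (c 1).
have := congr1 snd (E (1, i)); have := congr1 snd (E (1, i * Zp1)).
rewrite !permE /f hi hj /= => /(mulgI (i * Zp1)) <-.
by rewrite /i; case: (c 1).
Qed.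

Lemma odd_card_involution (T : finType) (f : T -> T) (A : {set T}) :
  involutive f -> {homo f : x / x \in A} ->
  odd #|A| = odd #|[set x in A | f x == x]|.
Proof.
move=> fK; elim: {A}#|A| {-2}A (leqnn #|A|) => [|n IH] A.
  by rewrite leqn0 cards_eq0 => /eqP-> _; congr (odd _); apply: eq_card => x; rewrite !inE.
move=> leA fA.
have [/forall_inP all_fix | /forall_inPn[x xA fx]] := boolP [forall x in A, f x == x].
  by congr (odd _); apply: eq_card => x; rewrite inE; case: (boolP (x \in A)) => // /all_fix ->.
pose B := A :\ x :\ f x.
have cA : #|A| = #|B|.+2.
  by rewrite (cardsD1 x) xA (cardsD1 (f x)) !inE fx fA.
rewrite cA /= negbK IH.
- congr (odd _); apply: eq_card => y; rewrite !inE.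
  have [-> | _] := eqVneq y (f x).
    by rewrite fK [x == _]eq_sym (negPf fx) !andbF.
  by have [->|_] := eqVneq y x; rewrite // (negPf fx) !andbF.
- by move: leA; rewrite cA ltnS => /ltnW.
move=> y; rewrite !inE => /and3P[yfx yx yA]; rewrite fA // andbT.
by rewrite (inj_eq (inv_inj fK)) yx (inv_eq fK).
Qed.

(** For the parity of the number of walks of length two only the elements with an
    odd number of square roots in [S] count; this replaces the set of squares,
    which is not invariant in general. *)
Definition odd_squares S := [set z | odd #|[set s in S | s ^+ 2 == z]|].

(** The common neighbours of [x] and [y] are mapped by [b] onto those of [a x] and
    [a y]; the parity of their number tells whether [y / x] is in
    [odd_squares S]. *)
Lemma odd_squares_aut S (a b : {perm gT}) :
  (forall x, x \in S -> x^-1 \in S) ->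
  twofold (cayley S) a b -> a \in graph_aut (cayley (odd_squares S)).
Proof.
move=> SV ab; pose C x y := [set z | cayley S x z && cayley S y z].
have SVE x : (x^-1 \in S) = (x \in S).
  by apply/idP/idP => /SV; rewrite ?invgK.
(* The reflection [z |-> x y / z] exchanges the two adjacencies that define the
   common neighbours of [x] and [y]. *)
have mirrorr x y z : x * y * z^-1 * y^-1 = (z * x^-1)^-1.
  by rewrite -(mulgA x) (abelian_mulC y) mulgA mulgK invMg invgK.
have mirrorl x y z : x * y * z^-1 * x^-1 = (z * y^-1)^-1.
  by rewrite (abelian_mulC x) mirrorr.
have mirror_fix x y z : (x * y * z^-1 == z) = ((z * x^-1) ^+ 2 == y * x^-1).
  have zz : z * x^-1 * z * x = z * z.
    by rewrite -(mulgA _ z) (abelian_mulC z x) mulgA mulgVK.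
  rewrite -(inj_eq (mulIg z) (x * y * _)) mulgVK -(inj_eq (mulIg x) _ (y * _)).
  rewrite -(inj_eq (mulIg x) (_ * x)) mulgVK.
  by rewrite expgS expg1 mulgA mulgVK zz (abelian_mulC x) eq_sym.
have oddC x y : odd #|C x y| = cayley (odd_squares S) x y.
  rewrite (@odd_card_involution _ (fun z => x * y * z^-1)).
  - rewrite /cayley inE -(card_imset _ (mulIg x^-1)); congr (odd _).
    apply: eq_card => s; apply/imsetP/idP => [[z]|].
      by rewrite !inE mirror_fix => /andP[/andP[xz _] zE] ->; apply/andP.
    rewrite inE => /andP[sS sE]; exists (s * x); last by rewrite mulgK.
    have fixE : x * y * (s * x)^-1 == s * x by rewrite mirror_fix mulgK.
    rewrite !inE fixE andbT /cayley mulgK sS /=.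
    by rewrite -{1}(eqP fixE) mirrorr mulgK SVE.
  - by move=> z; rewrite invMg invgK (abelian_mulC z) mulKVg.
  by move=> z; rewrite !inE /cayley mirrorl mirrorr !SVE andbC.
apply/graph_autP=> x y; rewrite -!oddC; congr (odd _).
rewrite -(card_imset (C x y) (@perm_inj _ b)); apply: eq_card => z.
by rewrite -[z](permKV b) mem_imset ?inE ?ab //; apply: perm_inj.
Qed.


(** Raising to the power [(#|K| + 1) / 2] inverts squaring. *)
Lemma odd_square_inj (K : {group gT}) :
  odd #|K| -> {in K &, injective (fun x : gT => x ^+ 2)}.
Proof.
move=> oddK.
have root x : x \in K -> (x ^+ 2) ^+ (#|K|.+1)./2 = x.
  move=> xK; rewrite -expgM mul2n halfK /= oddK subn0.
  by rewrite expgS expg_cardG // mulg1.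
by move=> x y xK yK /= E; rewrite -(root x) // E root.
Qed.

Lemma odd_squares_of_inj S :
  {in S &, injective (fun x : gT => x ^+ 2)} ->
  odd_squares S = [set s ^+ 2 | s in S].
Proof.
move=> inj; apply/setP=> z; rewrite inE; apply/idP/imsetP => [odd_z | [s sS ->]].
  have /set0Pn[s] : [set s in S | s ^+ 2 == z] != set0.
    by apply: contraTneq odd_z => ->; rewrite cards0.
  by rewrite inE => /andP[sS /eqP <-]; exists s.
suff -> : [set x in S | x ^+ 2 == s ^+ 2] = [set s] by rewrite cards1.
apply/setP=> x; rewrite !inE; apply/andP/eqP => [[xS /eqP] | -> //].
exact: inj.
Qed.

(** Squaring again and again, [a] preserves the graphs of the [2^i]-th powers of
    [R], and by Euler's theorem the one with [i = totient #|K|] is that of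
    [R]. *)
Lemma aut_unsquare (K : {group gT}) R (a : {perm gT}) :
  odd #|K| -> R \subset K -> (forall x, x \in R -> x^-1 \in R) ->
  a \in graph_aut (cayley (odd_squares R)) -> a \in graph_aut (cayley R).
Proof.
move=> oddK sRK RV aR.
have sqinj := odd_square_inj oddK.
pose P i := [set s ^+ (2 ^ i) | s : gT in R].
have PK i : P i \subset K.
  by apply/subsetP=> _ /imsetP[s sR ->]; rewrite groupX // (subsetP sRK).
have PV i x : x \in P i -> x^-1 \in P i.
  by case/imsetP=> s sR ->; apply/imsetP; exists s^-1; rewrite ?RV ?expVgn.
have PS i : odd_squares (P i) = P i.+1.
  rewrite odd_squares_of_inj; last first.
    by move=> x y xP yP; apply: sqinj; apply: (subsetP (PK i)).
  rewrite /P -imset_comp; apply: eq_imset => s /=.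
  by rewrite -expgM mulnC expnS.
have aP i : a \in graph_aut (cayley (P i.+1)).
  elim: i => [|i /graph_aut_twofold IH].
    rewrite -PS; have -> : P 0 = R; last by [].
    by rewrite /P -[RHS]imset_id; apply: eq_imset => s; rewrite expg1.
  by rewrite -PS; apply: odd_squares_aut IH; apply: PV.
have: a \in graph_aut (cayley (P (totient #|K|))).
  by rewrite -(prednK (_ : 0 < totient #|K|)) ?totient_gt0 ?cardG_gt0.
suff -> : P (totient #|K|) = R by [].
rewrite /P -[RHS]imset_id; apply: eq_in_imset => s sR.
have sK : s ^+ #|K| = 1 by rewrite expg_cardG // (subsetP sRK).
rewrite -(expg_mod _ sK) Euler_exp_totient ?coprime2n //.
by rewrite expg_mod // expg1.
Qed.

Lemma connected_sub_group S (K : {group gT}) :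
  connected_graph (cayley S) -> S \subset K -> forall x, x \in K.
Proof.
move=> conn sSK x; have /connectP[p] := conn 1 x.
elim: p 1 (group1 K) => [|z p IH] y yK /= => [_ -> //|/andP[yz pz]].
apply: IH pz; rewrite -(mulgVK y z) groupM //.
exact: (subsetP sSK).
Qed.

(** The cosets of the generated group are the connected components. *)
Lemma graph_aut_gen R : graph_aut (cayley R) \subset graph_aut (cayley <<R>>).
Proof.
have homo a x y : a \in graph_aut (cayley R) ->
    cayley <<R>> x y -> cayley <<R>> (a x) (a y).
  move=> /graph_autP aR; rewrite -{2}(mulgVK x y) {1}/cayley.
  pose P := [set m | [forall x, cayley <<R>> (a x) (a (m * x))]].
  have gP : group_set P.
    apply/group_setP; split=> [|m n]; rewrite !inE.
      by apply/forallP=> z; rewrite mul1g /cayley mulgV.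
    move=> /forallP mP /forallP nP; apply/forallP=> z.
    have := groupM (mP (n * z)) (nP z).
    by rewrite mulgA mulgVK mulgA.
  suff /subsetP sub : <<R>> \subset Group gP.
    by move/sub; rewrite inE => /forallP.
  rewrite gen_subG; apply/subsetP=> m mR; rewrite inE; apply/forallP=> z.
  by apply/mem_gen; have := aR z (m * z); rewrite /cayley mulgK mR.
apply/subsetP=> a aR; apply/graph_autP=> x y; apply/idP/idP; last exact: homo.
by move/(homo _ _ _ (groupVr aR)); rewrite !permK.
Qed.

(** The hypotheses say that [W] together with [1] is a subgroup, of order at least
    three.  Two vertices of a component are adjacent as soon as they have a common
    neighbour, which makes [a] preserve adjacency.  Then [a y] and [b y] have a
    common neighbour [a (w1 * y)], so if they differ they are adjacent, whereas
    [y] is not adjacent to itself. *)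
Lemma complete_twofold (W : {set gT}) w1 w2 (a b : {perm gT}) :
  1 \notin W -> (forall w, w \in W -> w^-1 \in W) ->
  {in W &, forall v w, v != w -> w * v^-1 \in W} ->
  w1 \in W -> w2 \in W -> w1 != w2 ->
  twofold (cayley W) a b -> a = b.
Proof.
move=> W1 WV Wdiff w1W w2W w12 ab; apply/permP=> y.
have Wsym x z : cayley W x z -> cayley W z x by move/WV; rewrite invMg invgK.
have tri x z u : x != z -> cayley W x u -> cayley W z u -> cayley W x z.
  move=> xz xu zu; have := Wdiff _ _ zu xu.
  rewrite (inj_eq (mulgI u)) (inj_eq invg_inj) eq_sym => /(_ xz).
  by rewrite invMg invgK (abelian_mulC (u * _)) mulgA mulgVK.
have aW x v : v \in W -> cayley W (a x) (a (v * x)).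
  move=> vW.
  have [w wW wv] : exists2 w, w \in W & w != v.
    by have [<-|] := eqVneq w1 v; [exists w2; rewrite // eq_sym | exists w1].
  apply: (tri _ _ (b (w * x))).
  - rewrite (inj_eq perm_inj); apply: contraNneq W1 => Ex.
    by rewrite -[1](mulgV x) {1}Ex mulgK.
  - by rewrite ab /cayley mulgK.
  by rewrite ab cayley_mulr /cayley Wdiff // eq_sym.
apply/eqP/negPn/negP=> aby.
have Eb : cayley W (b y) (a (w1 * y)).
  by apply/Wsym; rewrite ab; apply/Wsym; rewrite /cayley mulgK.
have Wab := tri _ _ _ aby (aW y w1 w1W) Eb.
by move: Wab; rewrite ab /cayley mulgV (negPf W1).
Qed.

End AbelianCayley.

(** * The even order case *)

(** The elements whose square is in [M] form a cyclic group [<[k]>] with [k ^+ 2]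
    in [M], and those outside [M] are odd powers of [k].  For trivial [M] this is
    the uniqueness of the involution. *)
Lemma cyclic_half_coset (gT : finGroupType) (M : {group gT}) (x y : gT) :
  cyclic [set: gT] -> x ^+ 2 \in M -> y ^+ 2 \in M ->
  x \notin M -> y \notin M -> x * y \in M.
Proof.
move=> cyc x2 y2 xM yM.
have mulC := abelian_mulC (cyclic_abelian cyc).
have gK : group_set [set z | z ^+ 2 \in M].
  apply/group_setP; split=> [|u v]; rewrite !inE ?expg1n // => uM vM.
  by rewrite expgMn; [apply: groupM | apply: mulC].
have /cyclicP[k Kk] : cyclic (Group gK) := cyclicS (subsetT _) cyc.
have k2 : k ^+ 2 \in M by have := cycle_id k; rewrite -Kk inE.
have even_M i : ~~ odd i -> k ^+ i \in M.
  by move/even_halfK <-; rewrite -mul2n expgM groupX.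
have /cycleP[i xi] : x \in <[k]> by rewrite -Kk inE.
have /cycleP[j yj] : y \in <[k]> by rewrite -Kk inE.
move: xM yM; rewrite xi yj => xM yM.
have odd_i : odd i by apply: contraNT xM => /even_M.
have odd_j : odd j by apply: contraNT yM => /even_M.
by rewrite -expgD even_M // oddD odd_i odd_j.
Qed.

Section EvenCirculant.

Variables (gT : finGroupType) (S : {set gT}) (t : gT).
Hypotheses (cyc : cyclic [set: gT]) (conS : connection_set S).
Hypotheses (conn : connected_graph (cayley S)).
Hypotheses (arcS : arc_transitive (cayley S)).
Hypotheses (nbip : ~ bipartite (cayley S)).
Hypotheses (vd : vertex_determining (cayley S)).
Hypotheses (t1 : t != 1) (t2 : t ^+ 2 = 1).

Let abG := cyclic_abelian cyc.
Let mulC := abelian_mulC abG.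
Let SV : forall x, x \in S -> x^-1 \in S.
Proof. by case: conS. Qed.
Let tt : t * t = 1 := t2.
Let tV : t^-1 = t.
Proof. by apply: (mulgI t); rewrite mulgV tt. Qed.
Let M : {group gT} := <<odd_squares S>>%G.

Lemma sqr_eq_involution x y : x ^+ 2 = y ^+ 2 -> x = y \/ x = y * t.
Proof.
move=> E; have [|xy] := eqVneq x y; [by left | right].
have xy2 : (x * y^-1) ^+ 2 = 1.
  by rewrite expgMn; [rewrite E expVgn mulgV | apply: mulC].
have : x * y^-1 * t \in 1%G.
  apply: cyclic_half_coset; rewrite ?xy2 ?t2 ?inE //.
  by apply: contraNneq xy => E1; rewrite -(mulgVK y x) E1 mul1g.
rewrite inE => /eqP E1; rewrite -[x](mulgVK y) mulC; congr (_ * _).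
by rewrite -[LHS]mulg1 -tt mulgA E1 mul1g.
Qed.

Lemma mem_odd_squares s : s \in S -> s * t \notin S -> s ^+ 2 \in odd_squares S.
Proof.
move=> sS stS; rewrite inE.
suff -> : [set x in S | x ^+ 2 == s ^+ 2] = [set s] by rewrite cards1.
apply/setP=> x; rewrite !inE; apply/andP/eqP => [[xS /eqP/sqr_eq_involution[] // E] | -> //].
by move: stS; rewrite -E xS.
Qed.

Lemma odd_squares_ex z : z \in odd_squares S ->
  exists2 s, s \in S & s * t \notin S /\ z = s ^+ 2.
Proof.
rewrite inE => odd_z.
have /set0Pn[s] : [set s in S | s ^+ 2 == z] != set0.
  by apply: contraTneq odd_z => ->; rewrite cards0.
rewrite inE => /andP[sS /eqP sz]; exists s => //; split => //.
apply: contraTN odd_z => stS.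
suff -> : [set x in S | x ^+ 2 == z] = [set s; s * t].
  rewrite cards2 -{1}[s]mulg1 (inj_eq (mulgI s)) eq_sym t1 //.
apply/setP=> x; rewrite !inE -sz; apply/andP/orP => [[xS /eqP/sqr_eq_involution[] ->]|].
- by left.
- by right.
case=> /eqP-> //; split=> //; rewrite expgMn ?t2 ?mulg1 //; exact: mulC.
Qed.

Lemma twofold_odd_squares a b :
  twofold (cayley S) a b -> a \in graph_aut (cayley (odd_squares S)).
Proof. exact: odd_squares_aut. Qed.

Lemma twofold_cosets a b :
  twofold (cayley S) a b -> a \in graph_aut (cayley M).
Proof.
by move/twofold_odd_squares; apply: (subsetP (graph_aut_gen _)).
Qed.

(** The only form in which arc-transitivity is used. *)
Lemma stabilizer_transitive s s' : s \in S -> s' \in S ->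
  exists g, [/\ twofold (cayley S) g g, g 1 = 1 & g s = s'].
Proof.
move=> sS s'S; have [||g gS [g1 gs]] := arcS (x := 1) (y := s) (u := 1) (v := s').
- by rewrite cayley1.
- by rewrite cayley1.
by exists g; split=> //; apply/graph_aut_twofold.
Qed.

Lemma even_card : ~~ odd #|[set: gT]|.
Proof.
have : #[t] %| #|[set: gT]| by apply: order_dvdG; rewrite inE.
suff -> : #[t] = 2 by rewrite dvdn2.
by apply: nt_prime_order.
Qed.

(** If one element of [S] is in [M] then all are, by arc-transitivity, and [M] is the
    whole group by connectedness.  But [M] consists of squares, and in even order a
    generator is not a square: its power by half the order of the group is not
    trivial. *)
Lemma connection_notin_squares s : s \in S -> s \notin M.
Proof.
move=> sS; apply/negP=> sM.
have SM : S \subset M.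
  apply/subsetP=> s' s'S.
  have [g [gS g1 gs]] := stabilizer_transitive sS s'S.
  have /graph_autP gM := twofold_cosets gS.
  by have := gM 1 s; rewrite g1 gs !cayley1 sM.
have MT := connected_sub_group conn SM.
pose n := #|[set: gT]|.
have gQ : group_set [set z : gT | z ^+ n./2 == 1].
  apply/group_setP; split=> [|u v]; rewrite !inE ?expg1n //.
  move=> /eqP u1 /eqP v1; rewrite expgMn; last exact: mulC.
  by rewrite u1 v1 mulg1.
have /subsetP MQ : M \subset Group gQ.
  rewrite gen_subG; apply/subsetP=> z /odd_squares_ex[x _ [_ ->]].
  by rewrite inE -expgM mul2n (even_halfK even_card) expg_cardG ?inE.
have /cyclicP[g Gg] := cyc.
have h2 : n./2.*2 = n := even_halfK even_card.
have h0 : 0 < n./2 by rewrite -double_gt0 h2 cardG_gt0.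
have := MQ g (MT g); rewrite inE -order_dvdn /order -Gg -/n => /(dvdn_leq h0).
by rewrite -{1}h2 -addnn -{3}[n./2]addn0 leq_add2l leqNgt h0.
Qed.

(** [D r] is the group of the [x] in [M] that have the same neighbours as [1] in the
    coset of [r].  The stabilizer of [1] permutes the cosets that meet [S]
    transitively, so the groups [D r] for [r] in [S] have equal orders; being
    subgroups of a cyclic group, they are equal.  An element common to all of them
    is a twin of [1]. *)
Lemma translation_period d s : s \in S -> d \in M ->
  (forall y, cayley M s y -> cayley S d y = (y \in S)) -> d = 1.
Proof.
move=> sS dM dper.
pose D s := [set d in M | [forall (y | cayley M s y), cayley S d y == cayley S 1 y]].
have inD r x : reflect (x \in M /\ forall y, cayley M r y -> cayley S x y = cayley S 1 y)
    (x \in D r).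
  rewrite inE; apply: (iffP andP) => -[xM H]; split=> //.
    by move=> y ry; move/forall_inP: H => /(_ y ry)/eqP.
  by apply/forall_inP=> y ry; rewrite H.
have gD r : group_set (D r).
  apply/group_setP; split; first by apply/inD.
  move=> x y /inD[xM xH] /inD[yM yH]; apply/inD; split=> [|z rz]; first exact: groupM.
  have -> : cayley S (x * y) z = cayley S x (z * y^-1).
    by rewrite -(cayley_mulr S y x) mulgVK.
  rewrite xH; first by rewrite -(cayley_mulr S y _ (z * _)) mulgVK mul1g yH.
  by rewrite /cayley -mulgA mulC -mulgA groupM ?groupV // mulC.
have leD r r' : r \in S -> r' \in S -> #|D r| <= #|D r'|.
  move=> rS r'S; have [g [gS g1 gr]] := stabilizer_transitive rS r'S.
  have /graph_autP gM := twofold_cosets gS.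
  rewrite -(card_imset _ (@perm_inj _ g)); apply/subset_leq_card/subsetP.
  move=> _ /imsetP[x /inD[xM xH] ->]; apply/inD; split.
    by have := gM 1 x; rewrite g1 !cayley1 xM.
  move=> y; rewrite -[y](permKV g) -gr gM => /xH; rewrite gS => ->.
  by rewrite -{2}g1 gS.
have eqD r : r \in S -> d \in D r.
  move=> rS; have : d \in D s by apply/inD; split=> // y /dper; rewrite cayley1.
  have := eq_subG_cyclic cyc (subsetT (Group (gD s))) (subsetT (Group (gD r))).
  by rewrite /= eqn_leq !leD // => /eqP->.
apply: vd; apply/setP=> y; rewrite !inE cayley1.
apply/idP/idP => [dy | yS].
  have /inD[_ H] := groupVr (eqD _ dy : _ \in Group (gD _)).
  have := H (y * d^-1); rewrite /cayley invgK invg1 mulg1 mulgVK mulgV group1.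
  by move=> ->.
have /inD[_ H] := eqD _ yS.
by rewrite H ?cayley1 // /cayley mulgV.
Qed.

(** The image of [S] in the quotient by [K] would be the involution, and the graph
    would be bipartite with [K] as a colour class. *)
Lemma coset_bipartite (K : {group gT}) :
  (forall s, s \in S -> s \notin K) -> (forall s, s \in S -> s ^+ 2 \in K) -> False.
Proof.
move=> SK S2; apply: nbip; exists (fun x => x \in K) => x y xy.
have gQ : group_set [set z : gT | z ^+ 2 \in K].
  apply/group_setP; split=> [|u v]; rewrite !inE ?expg1n // => u1 v1.
  by rewrite expgMn; [apply: groupM | apply: mulC].
have KT : forall z, z \in Group gQ.
  by apply: (connected_sub_group conn); apply/subsetP=> s; rewrite inE => /S2.
have [xK|xK] := boolP (x \in K).
  by rewrite -(mulgVK x y) groupMr // (negPf (SK _ xy)).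
suff -> : y \in K by [].
rewrite -(mulgVK x y); have := KT x; rewrite inE => x2.
apply: cyclic_half_coset => //; [exact: S2 | exact: SK].
Qed.

(** The elements [y] of [S] for which [y * t] is not in [S] have their square in
    [odd_squares S]. *)
Lemma mulr_involution y : y ^+ 2 \notin M -> (y * t \in S) = (y \in S).
Proof.
move=> y2; have yt2 : (y * t) ^+ 2 = y ^+ 2.
  by rewrite expgMn ?t2 ?mulg1 //; apply: mulC.
apply/idP/idP => yS; apply: contraR y2 => nyS; apply: mem_gen.
  by rewrite -yt2 mem_odd_squares // -mulgA tt mulg1.
exact: mem_odd_squares.
Qed.

Lemma coset_sqr x y : cayley M x y -> (y ^+ 2 \in M) = (x ^+ 2 \in M).
Proof.
move=> xy; rewrite -(mulgVK x y) expgMn; last exact: mulC.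
by rewrite groupMl // groupX.
Qed.

Lemma connection_sqr_notin : exists2 s, s \in S & s ^+ 2 \notin M.
Proof.
have [/exists_inP[s sS s2]|/exists_inPn H] := boolP [exists s in S, s ^+ 2 \notin M].
  by exists s.
case: (@coset_bipartite M); first exact: connection_notin_squares.
by move=> s /H; rewrite negbK.
Qed.

(** Otherwise [t] would be a period of the slice of [S] through an element whose
    square is not in [M]. *)
Lemma involution_notin_squares : t \notin M.
Proof.
apply/negP=> tM; have [s sS s2] := connection_sqr_notin.
case/eqP: t1; apply: (translation_period sS tM) => y sy.
have y2 : y ^+ 2 \notin M by rewrite (coset_sqr sy).
by rewrite -(mulr_involution y2) /cayley tV.
Qed.

Lemma odd_card_squares : odd #|M|.
Proof.
apply/negPn/negP; rewrite -dvdn2 => /(Cauchy (isT : prime 2))[u uM u2].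
have : u ^+ 2 = 1 ^+ 2 by rewrite -u2 expg_order expg1n.
case/sqr_eq_involution=> E; first by move: u2; rewrite E order1.
by move: uM; rewrite E mul1g (negPf involution_notin_squares).
Qed.

(** The slice of [S] by the coset [t M], brought back to [M]. *)
Definition fiber := [set m in M | m * t \in S].

Lemma fiberV m : m \in fiber -> m^-1 \in fiber.
Proof.
rewrite !inE => /andP[mM /SV]; by rewrite groupV mM invMg tV mulC.
Qed.

(** The elements [s] of [S] with [s * t] outside [S] are exactly those of the coset
    [t M]. *)
Lemma odd_squares_fiber : odd_squares fiber = odd_squares S.
Proof.
rewrite odd_squares_of_inj; last first.
  by move=> x y; rewrite !inE => /andP[xM _] /andP[yM _]; apply: odd_square_inj odd_card_squares _ _ _ _.
apply/setP=> z; apply/imsetP/idP => [[m] | zR].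
  rewrite !inE => /andP[mM mtS] ->.
  have -> : m ^+ 2 = (m * t) ^+ 2 by rewrite expgMn ?t2 ?mulg1 //; apply: mulC.
  have /mem_odd_squares H := mtS; have := H; rewrite inE; apply.
  by rewrite -mulgA tt mulg1; apply: contraL mM => /connection_notin_squares.
have zM : z \in M by apply: mem_gen.
have [s sS [stS E]] := odd_squares_ex zR.
exists (s * t); last by rewrite expgMn ?t2 ?mulg1 //; apply: mulC.
rewrite inE -mulgA tt mulg1 sS andbT.
by apply: cyclic_half_coset; rewrite ?t2 -?E ?(connection_notin_squares sS) ?involution_notin_squares.
Qed.

Lemma twofold_fiber a b :
  twofold (cayley S) a b -> a \in graph_aut (cayley fiber).
Proof.
move=> ab; apply: (aut_unsquare abG odd_card_squares); first by apply/subsetP=> m; rewrite inE => /andP[].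
  exact: fiberV.
by rewrite odd_squares_fiber; apply: twofold_odd_squares ab.
Qed.

(** Otherwise [S] is invariant under [t], and [1] and [t] are twins. *)
Lemma fiber_ex : exists m, m \in fiber.
Proof.
have [R0|/set0Pn[z]] := eqVneq (odd_squares fiber) set0; last first.
  rewrite inE; case: (pickP (mem fiber)) => [m mf _|f0]; first by exists m.
  suff -> : [set s in fiber | s ^+ 2 == z] = set0 by rewrite cards0.
  by apply/setP=> s; rewrite inE in_set0; have := f0 s; rewrite /= => ->.
case/eqP: t1; apply: vd; apply/setP=> y; rewrite !inE cayley1.
have St x : x \in S -> x * t \in S.
  move=> xS; apply/negPn/negP=> /(mem_odd_squares xS).
  by rewrite -odd_squares_fiber R0 inE.
by rewrite /cayley tV; apply/idP/idP => /St //; rewrite -mulgA tt mulg1.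
Qed.

Definition centers := [set w | [forall m in M, (m * w \in S) == (m \in fiber)]].

(** Being a center is expressed by adjacencies alone, which is why twofold pairs
    respect it. *)
Lemma cayley_centersP x y :
  reflect (forall z, cayley M y z -> cayley S x z = cayley fiber y z)
          (cayley centers x y).
Proof.
rewrite [cayley _ _ _]inE; apply: (iffP forall_inP) => H z.
  by move/H/eqP; rewrite mulgA mulgVK.
by move=> zM; have := H (z * y); rewrite /cayley mulgK -mulgA => ->.
Qed.

Lemma centersP w :
  reflect (forall m, m \in M -> (m * w \in S) = (m \in fiber)) (w \in centers).
Proof.
by rewrite inE; apply: (iffP forall_inP) => H m /H; [move/eqP | move->].
Qed.

Lemma twofold_centers a b : twofold (cayley S) a b -> twofold (cayley centers) a b.
Proof.
have homo c d x y : twofold (cayley S) c d ->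
    cayley centers x y -> cayley centers (c x) (d y).
  move=> cd; have dc := twofold_sym (cayley_symmetric conS) cd.
  have /graph_autP dM := twofold_cosets dc; have /graph_autP df := twofold_fiber dc.
  move/cayley_centersP=> H; apply/cayley_centersP=> z.
  by rewrite -[z](permKV d) dM cd df => /H.
move=> ab x y; apply/idP/idP; last exact: homo.
by move/(homo _ _ _ _ (twofold_inv ab)); rewrite !permK.
Qed.

Lemma t_center : t \in centers.
Proof. by apply/centersP=> m mM; rewrite inE mM. Qed.

(** A period of [fiber] is a period of the slice of [S] by [t M]. *)
Lemma fiber_period d :
  d \in M -> {in M, forall m, (m * d \in fiber) = (m \in fiber)} -> d = 1.
Proof.
move=> dM H; have [m0] := fiber_ex; rewrite inE => /andP[m0M m0S].
apply/eqP; rewrite -invg_eq1; apply/eqP.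
apply: (translation_period m0S); rewrite ?groupV // => y m0y.
have yM : y * t \in M.
  have := groupM m0y m0M; rewrite invMg tV mulgA mulgVK.
  by [].
have := H _ yM; rewrite !inE yM groupM //= -[y * t * t]mulgA tt mulg1.
by rewrite -mulgA (mulC d) mulgA -[y * t * t]mulgA tt mulg1 /cayley invgK.
Qed.

Lemma center_uniq w w' :
  w \in centers -> w' \in centers -> cayley M w w' -> w = w'.
Proof.
move=> /centersP wW /centersP w'W ww'.
suff /eqP : w' * w^-1 = 1 by rewrite -eq_mulgV1 => /eqP.
apply: fiber_period => // m mM.
by rewrite -wW ?(groupM mM ww') // mulgA mulgVK w'W.
Qed.

Lemma center_notin_squares w : w \in centers -> w \notin M.
Proof.
move=> /centersP wW; have [m mf] := fiber_ex.
have mM : m \in M by move: mf; rewrite inE => /andP[].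
by rewrite -(groupMl w mM) connection_notin_squares // wW.
Qed.

Lemma center_far w : w \in centers -> w != t -> w ^+ 2 \notin M.
Proof.
move=> wW; apply: contraNN => w2; apply/eqP/esym.
apply: center_uniq => //; first exact: t_center.
rewrite /cayley tV; apply: cyclic_half_coset; rewrite ?t2 //.
  exact: center_notin_squares.
exact: involution_notin_squares.
Qed.

(** The slice by [M w] consists of elements whose square is not in [M], so it is
    carried by [t] to another slice. *)
Lemma center_mulr_involution w : w \in centers -> w != t -> w * t \in centers.
Proof.
move=> wW wt; have w2 := center_far wW wt; apply/centersP=> m mM.
have mw : cayley M w (m * w) by rewrite /cayley mulgK.
by rewrite mulgA mulr_involution ?(coset_sqr mw) //; apply/centersP.
Qed.

Lemma centerV w : w \in centers -> w^-1 \in centers.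
Proof.
move=> /centersP wW; apply/centersP=> m mM.
have SVE x : (x^-1 \in S) = (x \in S).
  by apply/idP/idP => /SV; rewrite ?invgK.
rewrite -SVE invMg invgK mulC wW ?groupV //.
by apply/idP/idP => /fiberV; rewrite ?invgK.
Qed.

(** The slice through [s] is the image of the slice by [t M] under an automorphism
    fixing [1], and the center [t] of the latter goes to a center. *)
Lemma center_of_S s : s \in S ->
  exists g, [/\ twofold (cayley S) g g, g 1 = 1, g t \in centers & cayley M s (g t)].
Proof.
move=> sS; have [m] := fiber_ex; rewrite inE => /andP[mM mS].
have [g [gS g1 gs]] := stabilizer_transitive mS sS; exists g; split=> //.
  by rewrite -cayley1 -{1}g1 (twofold_centers gS) cayley1 t_center.
have /graph_autP gM := twofold_cosets gS.
by rewrite -gs gM /cayley invMg mulgA mulgV mul1g groupV.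
Qed.

Lemma center_transitive w : w \in centers ->
  exists g, [/\ twofold (cayley S) g g, g 1 = 1 & g t = w].
Proof.
move=> wW; have /centersP wP := wW; have [m mf] := fiber_ex.
have mM : m \in M by move: mf; rewrite inE => /andP[].
have mwS : m * w \in S by rewrite wP.
have [g [gS g1 gt wgt]] := center_of_S mwS; exists g; split=> //.
apply/esym/center_uniq => //.
by move: wgt; rewrite /cayley invMg mulgA groupMr ?groupV.
Qed.

(** Let [g] map [1] to [1] and [t] to [v].  The center [u] that [g] maps to [w]
    differs from [t], so [u * t], which is the quotient of [u] by [t], is a center;
    apply [g] to this adjacency. *)
Lemma center_diff : {in centers &, forall v w, v != w -> w * v^-1 \in centers}.
Proof.
move=> v w vW wW vw; have [g [gS g1 gt]] := center_transitive vW.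
have gW := twofold_centers gS.
have uW : g^-1 w \in centers by rewrite -cayley1 -gW g1 permKV cayley1.
have ut : g^-1 w != t by apply: contraNneq vw => ut; rewrite -gt -ut permKV.
have := center_mulr_involution uW ut; rewrite -tV -/(cayley centers t (g^-1 w)).
by rewrite -gW gt permKV.
Qed.

Lemma even_twofold_eq a b : twofold (cayley S) a b -> a = b.
Proof.
move=> ab; have [s sS s2] := connection_sqr_notin.
have [g [_ _ gW gs]] := center_of_S sS.
apply: (complete_twofold abG _ centerV center_diff t_center gW _ (twofold_centers ab)).
  by apply/negP=> /center_notin_squares; rewrite group1.
by apply: contraNneq s2 => E; rewrite -(coset_sqr gs) -E t2.
Qed.

End EvenCirculant.

(** * Stability of arc-transitive circulants *)
Lemma circulant_twofold_eq (gT : finGroupType) (S : {set gT}) (a b : {perm gT}) :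
  cyclic [set: gT] -> connection_set S -> connected_graph (cayley S) ->
  arc_transitive (cayley S) -> ~ bipartite (cayley S) ->
  vertex_determining (cayley S) -> twofold (cayley S) a b -> a = b.
Proof.
move=> cyc conS conn arcS nbip vd ab; have abG := cyclic_abelian cyc.
have SV : forall x, x \in S -> x^-1 \in S by case: conS.
have [oddG|] := boolP (odd #|[set: gT]%G|).
  apply: (twofold_aut_eq vd (cayley_symmetric conS) ab).
  apply: (aut_unsquare abG oddG (subsetT S) SV).
  exact: odd_squares_aut ab.
rewrite -dvdn2 => /(Cauchy (isT : prime 2))[t _ ordt].
have t1 : t != 1 by apply/eqP=> E; move: ordt; rewrite E order1.
have t2 : t ^+ 2 = 1 by rewrite -ordt expg_order.
exact: (even_twofold_eq cyc conS conn arcS nbip vd t1 t2 ab).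
Qed.

Theorem theorem1p6 :
  (~ exists (gT : finGroupType) (S : {set gT}),
       [/\ cyclic [set: gT], connection_set S, arc_transitive (cayley S)
         & nontrivially_unstable (cayley S)])
  /\
  (forall (gT : finGroupType) (S : {set gT}),
     cyclic [set: gT] -> connection_set S ->
     connected_graph (cayley S) -> arc_transitive (cayley S) ->
     (stable_graph (cayley S) <->
      ~ bipartite (cayley S) /\ vertex_determining (cayley S))).
Proof.
have stable (gT : finGroupType) (S : {set gT}) :
    cyclic [set: gT] -> connection_set S -> connected_graph (cayley S) ->
    arc_transitive (cayley S) -> ~ bipartite (cayley S) ->
    vertex_determining (cayley S) -> stable_graph (cayley S).
  move=> cyc conS conn arcS nbip vd.
  apply: (stable_of_twofold (1 : gT) conn nbip) => a b.
  exact: circulant_twofold_eq.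
split=> [[gT [S [cyc conS arcS [conn nbip vd]]]]|gT S cyc conS conn arcS].
  by apply; apply: stable.
split=> [st|[nbip vd]]; last exact: stable.
split; first exact: (stable_nonbipartite (cyclic_abelian cyc) conS st).
apply: stable_vertex_determining st.
  exact: cayley_irreflexive.
exact: cayley_symmetric.
Qed.
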